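(* For $n \geq 3$, let $\mathcal{T}(n)$ be the class of trees that have a unique vertex of maximum degree, this maximum degree being $n+1$, and such that the removal of this vertex results in components that have maximum degree at most $n-1$. Then for every $n \geq 3$ and every $T \in \mathcal{T}(n)$, there is $k \in \mathbb{N}$ such that $\square^n K_k$ is $T$-induced-saturated.
   Context: All graphs are finite and simple; $\mathbb{N}=\{1,2,\dots\}$. For graphs $H,G$, write $H \subseteq_I G$ if $G$ contains an induced subgraph isomorphic to $H$. A graph $G$ on at least two vertices is $H$-induced-saturated if $H \not\subseteq_I G$, but $H \subseteq_I G - e$ for every edge $e \in E(G)$ and $H \subseteq_I G + e$ for every edge $e \in E(\overline{G})$ of the complement. $\square^n K_k$ is the Cartesian product of $n$ cliques of order $k$: its vertices are all $n$-tuples with entries in a fixed $k$-element set, two tuples being adjacent iff they differ in exactly one coordinate. *)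

(* Defs.v *)
From HB Require Import structures.
From mathcomp Require Import all_boot.
Set Implicit Arguments.
Unset Strict Implicit.
Unset Printing Implicit Defensive.

Record sgraph := SGraph {
  vert :> finType;
  adj : rel vert;
  adj_sym : symmetric adj;
  adj_irr : irreflexive adj }.

Definition edges (G : sgraph) : {set {set G}} :=
  [set [set p.1; p.2] | p : G * G & adj p.1 p.2].

Definition isomorphic (G H : sgraph) : Prop :=
  exists f : G -> H, bijective f /\ forall x y, adj (f x) (f y) = adj x y.

Section Operations.
Variable G : sgraph.

Definition compl_adj : rel G := fun x y => (x != y) && ~~ adj x y.
Lemma compl_sym : symmetric compl_adj.
Proof. by move=> x y; rewrite /compl_adj eq_sym adj_sym. Qed.
Lemma compl_irr : irreflexive compl_adj.
Proof. by move=> x; rewrite /compl_adj eqxx. Qed.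
Definition compl : sgraph := SGraph compl_sym compl_irr.

Definition del_adj (e : {set G}) : rel G :=
  fun x y => adj x y && ([set x; y] != e).
Lemma del_sym e : symmetric (del_adj e).
Proof. by move=> x y; rewrite /del_adj adj_sym setUC. Qed.
Lemma del_irr e : irreflexive (del_adj e).
Proof. by move=> x; rewrite /del_adj adj_irr. Qed.
Definition del_edge (e : {set G}) : sgraph := SGraph (@del_sym e) (@del_irr e).

(* The guard [x != y] only keeps the relation irreflexive when [e] is not a
   pair of distinct vertices. *)
Definition add_adj (e : {set G}) : rel G :=
  fun x y => (x != y) && (adj x y || ([set x; y] == e)).
Lemma add_sym e : symmetric (add_adj e).
Proof. by move=> x y; rewrite /add_adj eq_sym adj_sym setUC. Qed.
Lemma add_irr e : irreflexive (add_adj e).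
Proof. by move=> x; rewrite /add_adj eqxx. Qed.
Definition add_edge (e : {set G}) : sgraph := SGraph (@add_sym e) (@add_irr e).

Definition induced_adj (S : {set G}) : rel {x : G | x \in S} :=
  fun x y => adj (val x) (val y).
Lemma induced_sym S : symmetric (@induced_adj S).
Proof. by move=> x y; rewrite /induced_adj adj_sym. Qed.
Lemma induced_irr S : irreflexive (@induced_adj S).
Proof. by move=> x; rewrite /induced_adj adj_irr. Qed.
Definition induced (S : {set G}) : sgraph :=
  SGraph (@induced_sym S) (@induced_irr S).

End Operations.

Definition induced_sub (H G : sgraph) : Prop :=
  exists S : {set G}, isomorphic H (induced S).

Definition induced_saturated (H G : sgraph) : Prop :=
  [/\ 2 <= #|G|,
      ~ induced_sub H G,
      forall e : {set G}, e \in edges G -> induced_sub H (del_edge e)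
    & forall e : {set G}, e \in edges (compl G) -> induced_sub H (add_edge e)].

Definition degree (G : sgraph) (x : G) : nat := #|[set y | adj x y]|.

Definition max_degree (G : sgraph) : nat := \max_(x : G) degree x.

Definition connected (G : sgraph) : Prop :=
  0 < #|G| /\ forall x y : G, connect (@adj G) x y.

Definition acyclic (G : sgraph) : Prop :=
  forall s : seq G, 3 <= size s -> ~ ucycle (@adj G) s.

Definition is_tree (G : sgraph) : Prop := connected G /\ acyclic G.

Definition components (G : sgraph) : {set {set G}} :=
  [set [set y | connect (@adj G) x y] | x : G].

Definition del_vertex (G : sgraph) (v : G) : sgraph := induced [set~ v].

Definition tree_class (n : nat) (T : sgraph) : Prop :=
  is_tree T /\
  exists v : T,
    [/\ unique (fun u : T => degree u = max_degree T) v,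
        max_degree T = n.+1
      & forall C : {set del_vertex v}, C \in components (del_vertex v) ->
          max_degree (induced C) <= n - 1].

Section Hamming.
Variables n k : nat.

Definition hamming_adj : rel {ffun 'I_n -> 'I_k} :=
  fun x y => #|[set i | x i != y i]| == 1.
Lemma hamming_sym : symmetric hamming_adj.
Proof.
move=> x y; rewrite /hamming_adj; congr (_ == 1).
by apply: eq_card => i; rewrite !inE eq_sym.
Qed.
Lemma hamming_irr : irreflexive hamming_adj.
Proof.
move=> x; rewrite /hamming_adj; suff -> : [set i | x i != x i] = set0.
  by rewrite cards0.
by apply/setP => i; rewrite !inE eqxx.
Qed.
(* The n-th Cartesian power of the complete graph on k vertices. *)
Definition hamming : sgraph := SGraph hamming_sym hamming_irr.

End Hamming.

(* Main.v *)
Require Import Defs.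
From mathcomp Require Import all_boot.
Set Implicit Arguments.
Unset Strict Implicit.
Unset Printing Implicit Defensive.

(** A vertex of [hamming n k] has no [n + 1] pairwise nonadjacent neighbours,
    because its neighbourhood is a union of [n] cliques; so the tree [T] is not
    an induced subgraph. Once an edge is deleted or added, the vertex [v] of
    degree [n + 1] can be placed: on a third point of the line through a deleted
    edge, with the ends of that edge as two of its neighbours, or on one end of
    an added edge, with the other end as a neighbour. The rest of [T] is then
    embedded greedily: a new neighbour of [p] is obtained from the image of [p]
    by giving a fresh value to a coordinate not yet used for a neighbour of that
    image. Every vertex [p] keeps enough unused coordinates for its remaining
    neighbours, and freshness rules out unwanted adjacencies. *)

(** * Connected vertex sets in acyclic graphs *)

Section Acyclic.
Variables (T : sgraph) (acT : acyclic T).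

Lemma acyclic_triangle_free (x y z : T) :
  adj x y -> adj y z -> ~~ adj x z.
Proof.
move=> xy yz; apply/negP => xz.
apply: (acT (s := [:: x; y; z])) => //.
have neq (a b : T) : adj a b -> a != b.
  by apply: contraTneq => ->; rewrite adj_irr.
by rewrite /ucycle /= xy yz (adj_sym z) xz !inE negb_or !neq.
Qed.

Definition adj_in (S : {set T}) : rel T :=
  fun x y => [&& adj x y, x \in S & y \in S].

Lemma adj_in_sym S : symmetric (adj_in S).
Proof. by move=> x y; rewrite /adj_in adj_sym (andbC (x \in S)). Qed.

Definition connected_in (S : {set T}) :=
  {in S &, forall x y, connect (adj_in S) x y}.

Lemma connected_inU1 (S : {set T}) p w :
  connected_in S -> p \in S -> adj p w -> connected_in (w |: S).
Proof.
move=> cS pS pw.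
have sub x y : connect (adj_in S) x y -> connect (adj_in (w |: S)) x y.
  apply: connect_sub => a b /and3P[ab aS bS].
  by apply: connect1; rewrite /adj_in ab !in_setU1 aS bS !orbT.
have con x : x \in w |: S -> connect (adj_in (w |: S)) p x.
  case/setU1P=> [->|xS]; last exact/sub/cS.
  by apply: connect1; rewrite /adj_in pw !in_setU1 pS eqxx orbT.
move=> x y xS yS; apply: connect_trans (con y yS).
by rewrite (sym_connect_sym (adj_in_sym _)) con.
Qed.

(** A path inside [S] between two such vertices would close up through [w] to a cycle. Hence a
    vertex added to a connected set has only one neighbour in it. *)
Lemma connected_in_adj_unique (S : {set T}) p q w : connected_in S ->
  p \in S -> q \in S -> w \notin S -> adj p w -> adj q w -> p = q.
Proof.
move=> cS pS qS wS pw qw; apply/eqP/negPn/negP => pq.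
have /connectP[s0 path0 last0] := cS p q pS qS.
case/shortenP: path0 last0 => s path_s uniq_s _ last_s.
have adj_s : path (@adj T) p s.
  by apply: sub_path path_s => a b /and3P[].
have sS : {subset p :: s <= S}.
  elim: s p pS path_s {uniq_s last_s adj_s pw pq} => [|a s IH] p pS /=.
    by move=> _ x; rewrite inE => /eqP->.
  case/andP=> /and3P[_ _ aS] /(IH _ aS) sub x; rewrite inE.
  by case/predU1P=> [->//|]; apply: sub.
apply: (acT (s := [:: w, p & s])).
  (* The cycle has length at least 3 because [p != q] makes [s] nonempty. *)
  by case: s last_s {path_s uniq_s adj_s sS} => //= E; rewrite E eqxx in pq.
apply/andP; split.
  by rewrite /= rcons_path adj_sym pw adj_s -last_s qw.
by rewrite cons_uniq uniq_s andbT; apply: contra wS; apply: sS.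
Qed.

End Acyclic.

(** Without a crossing edge, [S] would be closed under adjacency and contain everything reachable
    from [x]. *)
Lemma connected_crossing (T : sgraph) (S : {set T}) x :
  connected T -> x \in S -> S != setT ->
  exists p w, [/\ p \in S, w \notin S & adj p w].
Proof.
case=> _ cT xS ST.
have [/existsP[p /existsP[w /and3P[]]]|none] :=
  boolP [exists p, exists w, [&& p \in S, w \notin S & adj p w]].
  by exists p, w.
have clS : closed (@adj T) [in S].
  apply: intro_closed; first exact: (sym_connect_sym (@adj_sym T)).
  move=> p w pw pS; apply: contraR none => wS.
  by apply/existsP; exists p; apply/existsP; exists w; rewrite pS wS.
case/eqP: ST; apply/setP => y.
by rewrite inE -(closed_connect clS (cT x y)).
Qed.

(** * Induced subgraphs as injective maps *)

Lemma induced_sub_inj (H G : sgraph) (f : H -> G) :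
  injective f -> (forall x y, adj (f x) (f y) = adj x y) -> induced_sub H G.
Proof.
move=> inj_f adj_f; exists [set f x | x in H].
have fP x : f x \in [set f x | x in H] by apply: imset_f.
exists (fun x => Sub (f x) (fP x)); split=> //.
apply: inj_card_bij; first by move=> x y [] /inj_f.
by rewrite card_sig (eq_card (B := [set f x | x in H])) ?card_imset.
Qed.

Lemma induced_subP (H G : sgraph) : induced_sub H G ->
  exists2 f : H -> G, injective f & forall x y, adj (f x) (f y) = adj x y.
Proof.
case=> S [f [bij_f adj_f]]; exists (fun x => val (f x)) => //.
by move=> x y /val_inj /(bij_inj bij_f).
Qed.

(** * Coordinates in which two tuples differ *)

Section Diff.
Variables n k : nat.
Implicit Types x y z : {ffun 'I_n -> 'I_k}.

Definition diff x y := [set i | x i != y i].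

Lemma diffC x y : diff x y = diff y x.
Proof. by apply/setP => i; rewrite !inE eq_sym. Qed.

Lemma diff_eq0 x y : (diff x y == set0) = (x == y).
Proof.
apply/eqP/eqP => [D0|->]; last by apply/setP => i; rewrite !inE eqxx.
apply/ffunP => i; apply/eqP; apply: contraFT (in_set0 i) => xy.
by rewrite -D0 inE.
Qed.

Lemma diffxx x : diff x x = set0.
Proof. by apply/eqP; rewrite diff_eq0. Qed.

Lemma diffxx_set1 x i : (diff x x == [set i]) = false.
Proof. by rewrite diffxx eq_sym -cards_eq0 cards1. Qed.

Lemma hamming_adjP x y :
  reflect (exists i, diff x y = [set i]) (hamming_adj x y).
Proof. exact: cards1P. Qed.

(** Off coordinate [i] both [y] and [z] agree with [x], hence with each other. *)
Lemma diff_line x y z i :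
  diff x y = [set i] -> diff x z = [set i] -> y != z -> hamming_adj y z.
Proof.
move=> xy xz yz; apply/hamming_adjP; exists i.
have: diff y z \subset [set i].
  apply/subsetP => j; apply: contraLR => ji.
  have: j \notin diff x y by rewrite xy.
  have: j \notin diff x z by rewrite xz.
  by rewrite !inE !negbK => /eqP-> /eqP->.
by rewrite subset1 diff_eq0 (negPf yz) orbF => /eqP.
Qed.

Definition upd x i (c : 'I_k) : {ffun 'I_n -> 'I_k} :=
  [ffun j => if j == i then c else x j].

Lemma diff_upd x y i c : c != y i -> diff (upd x i c) y = i |: diff x y.
Proof.
move=> cy; apply/setP => j; rewrite !inE ffunE.
by have [->|] := eqVneq j i; rewrite ?cy.
Qed.

End Diff.

(** * Greedy extension of partial embeddings *)

Section Greedy.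
Variables (T : sgraph) (n k : nat).
Hypotheses (acT : acyclic T) (conT : connected T) (k_gt : #|T| < k).
(* [A] is the adjacency of [hamming n k] after changing the edge [E]; keeping
   [E] inside the image makes every later point see the Hamming adjacency. *)
Variables (E : {set {ffun 'I_n -> 'I_k}}) (A : rel {ffun 'I_n -> 'I_k}).
Hypothesis A_sym : symmetric A.
Hypothesis A_irr : irreflexive A.
Hypothesis A_hamming : forall x y, x \notin E -> A x y = hamming_adj x y.

(** Directions count Hamming adjacency, not [A]: a deleted edge still occupies its direction, an
    added edge occupies none. *)
Definition dirs (S : {set T}) (f : T -> {ffun 'I_n -> 'I_k}) p :=
  [set i | [exists q in S, diff (f p) (f q) == [set i]]].

Definition missing (S : {set T}) (p : T) := [set u | adj p u & u \notin S].

(** The invariant of the greedy process. Placing a neighbour of [p] trades one missing neighbour for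
    at most one used direction, so the sum in [pe_room] does not grow; [pe_degree] secures [pe_room]
    for vertices placed later. *)
Record partial_embedding
    (S : {set T}) (f : T -> {ffun 'I_n -> 'I_k}) : Prop := {
  pe_connected : connected_in S;
  pe_support : E \subset f @: S;
  pe_inj : {in S &, injective f};
  pe_adj : {in S &, forall p q, A (f p) (f q) = adj p q};
  pe_room : {in S, forall p, #|dirs S f p| + #|missing S p| <= n};
  pe_degree : forall p, p \notin S -> degree p <= n }.

Lemma missing_card_degree (S : {set T}) p w :
  w \in S -> adj p w -> #|missing S p| < degree p.
Proof.
move=> wS pw; apply: proper_card; apply/properP; split.
  by apply/subsetP => u; rewrite !inE => /andP[].
by exists w; rewrite !inE ?pw ?wS.
Qed.

Lemma partial_embedding_extend S f p w : partial_embedding S f ->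
  p \in S -> w \notin S -> adj p w ->
  exists g, partial_embedding (w |: S) g.
Proof.
case=> cS supp inj_f adj_f room degS pS wS pw.
have w_missing : w \in missing S p by rewrite inE pw wS.
(* Since [w] is itself missing at [p], [pe_room] leaves fewer than [n] used directions. *)
have [i iD] : exists i, i \notin dirs S f p.
  apply/existsP; rewrite -negb_forall; apply/negP => /forallP all_i.
  have := room p pS; rewrite leqNgt (_ : dirs S f p = setT).
    by rewrite cardsT card_ord -addn1 leq_add2l (cardD1 w) w_missing.
  by apply/setP => j; rewrite all_i inE.
(* As [#|T| < k], some value is not taken in coordinate [i] by any image so far. *)
have [c cS'] : exists c, c \notin [set f q i | q in S].
  apply/existsP; rewrite -negb_forall; apply/negP => /forallP all_c.
  have := leq_imset_card (fun q => f q i) S.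
  rewrite (_ : [set f q i | q in S] = setT).
    rewrite cardsT card_ord leqNgt => /negP; apply.
    exact: leq_ltn_trans (max_card _) k_gt.
  by apply/setP => j; rewrite all_c inE.
have fresh q : q \in S -> c != f q i.
  by move=> qS; apply: contraNneq cS' => ->; apply: (imset_f (fun q => f q i)).
pose x := upd (f p) i c.
have diff_x q : q \in S -> diff x (f q) = i |: diff (f p) (f q).
  by move=> qS; rewrite diff_upd ?fresh.
have diff_xp : diff x (f p) = [set i].
  by rewrite diff_x // diffxx setU0.
(* This difference always contains [i]. Were it a singleton, [f q] would equal [f p] or differ from
   it in [i] alone, making [i] a used direction. *)
have diff_far q j : q \in S -> q != p -> diff x (f q) != [set j].
  move=> qS qp; rewrite diff_x //; apply/negP => /eqP eq_j.
  have eq_ij : j = i by apply/esym/set1P; rewrite -eq_j setU11.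
  have: diff (f p) (f q) \subset [set i] by rewrite -eq_ij -eq_j subsetUr.
  rewrite subset1 diff_eq0 => /orP[pq|/eqP/inj_f pq]; last first.
    by rewrite pq ?eqxx in qp.
  by case/negP: iD; rewrite inE; apply/existsP; exists q; rewrite qS.
have x_new q : q \in S -> x != f q.
  move=> qS; rewrite -diff_eq0 diff_x //; apply/set0Pn.
  by exists i; rewrite setU11.
have xE : x \notin E.
  apply/negP => /(subsetP supp)/imsetP[q qS eq_x].
  by have := x_new q qS; rewrite eq_x eqxx.
have Ax q : q \in S -> A x (f q) = adj w q.
  move=> qS; rewrite A_hamming //; have [->|qp] := eqVneq q p.
    by rewrite adj_sym pw; apply/hamming_adjP; exists i.
  have -> : adj w q = false.
    apply: contraNF qp; rewrite adj_sym => qw; apply/eqP.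
    exact: (connected_in_adj_unique acT cS qS pS wS qw pw).
  apply/negP => /hamming_adjP[j eq_j].
  by have := diff_far q j qS qp; rewrite eq_j eqxx.
pose g u := if u == w then x else f u.
have gw : g w = x by rewrite /g eqxx.
have gS q : q \in S -> g q = f q.
  by move=> qS; rewrite /g (negPf (contraNneq _ wS)) // => <-.
have dirsE q : dirs (w |: S) g q =
    [set j | (diff (g q) x == [set j])
          || [exists r in S, diff (g q) (f r) == [set j]]].
  apply/setP => j; rewrite !inE; apply/existsP/orP.
    case=> r /andP[/setU1P[->|rS]]; first by rewrite gw; left.
    by rewrite (gS r rS) => D; right; apply/existsP; exists r; rewrite rS.
  case=> [D|/existsP[r /andP[rS D]]]; first by exists w; rewrite setU11 gw.
  by exists r; rewrite setU1r ?(gS r rS).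
have missing_sub q : missing (w |: S) q = missing S q :\ w.
  by apply/setP => u; rewrite !inE negb_or andbCA.
exists g; split.
- exact: connected_inU1 cS pS pw.
- apply: subset_trans supp _; apply/subsetP => _ /imsetP[q qS ->].
  by rewrite -gS //; apply: imset_f; rewrite setU1r.
- move=> q r /setU1P[->|qS] /setU1P[->|rS] //; rewrite ?gw ?gS //.
  + by move=> /eqP; rewrite (negPf (x_new _ _)).
  + by move=> /esym/eqP; rewrite (negPf (x_new _ _)).
  + exact: inj_f.
- move=> q r /setU1P[->|qS] /setU1P[->|rS]; rewrite ?gw ?gS //.
  + by rewrite A_irr adj_irr.
  + exact: Ax.
  + by rewrite A_sym adj_sym Ax.
  + exact: adj_f.
- move=> q /setU1P[->|qS].
    (* The new vertex uses only the direction towards [p], and its neighbour [p] is already placed,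
       so [degree w <= n] suffices. *)
    have dirs_w : dirs (w |: S) g w \subset [set i].
      apply/subsetP => j; rewrite dirsE gw !inE => /orP[|/existsP[r /andP[rS]]].
        by rewrite diffxx_set1.
      have [->|rp] := eqVneq r p; last by rewrite (negPf (diff_far _ _ _ _)).
      by rewrite diff_xp (inj_eq set1_inj) eq_sym.
    apply: leq_trans (degS w wS).
    apply: (@leq_trans (1 + #|missing (w |: S) w|)).
      by rewrite leq_add2r (leq_trans (subset_leq_card dirs_w)) ?cards1.
    apply: (@missing_card_degree _ _ p); first by rewrite setU1r.
    by rewrite adj_sym.
  have [->|qp] := eqVneq q p.
    have dirs_p : dirs (w |: S) g p \subset i |: dirs S f p.
      apply/subsetP => j; rewrite dirsE gS // !inE.
      case/orP=> [|->]; last exact: orbT.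
      by rewrite diffC diff_xp (inj_eq set1_inj) eq_sym => ->.
    apply: leq_trans (room p pS); rewrite missing_sub (cardsD1 w (missing S p)).
    rewrite w_missing addnA leq_add2r.
    by rewrite (leq_trans (subset_leq_card dirs_p)) // cardsU1 iD add1n addn1.
  have dirs_q : dirs (w |: S) g q \subset dirs S f q.
    apply/subsetP => j; rewrite dirsE gS // !inE => /orP[|->//].
    by rewrite diffC (negPf (diff_far _ _ _ _)).
  apply: leq_trans (room q qS); rewrite leq_add ?subset_leq_card //.
  by rewrite missing_sub subD1set.
- by move=> q; rewrite in_setU1 negb_or => /andP[_ /degS].
Qed.

Lemma partial_embedding_total (S : {set T}) f x :
  x \in S -> partial_embedding S f ->
  exists2 g : T -> {ffun 'I_n -> 'I_k},
    injective g & forall p q, A (g p) (g q) = adj p q.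
Proof.
(* Induction on the number of vertices not yet placed. *)
elim: {S}_.+1 {-2}S (ltnSn #|~: S|) f => // m IH S ltSm f xS emb.
have [ST|ST] := eqVneq S setT.
  exists f => [p q|p q]; first by apply: (pe_inj emb); rewrite ST inE.
  by apply: (pe_adj emb); rewrite ST inE.
have [p [w [pS wS pw]]] := connected_crossing conT xS ST.
have [g emb_g] := partial_embedding_extend emb pS wS pw.
apply: IH emb_g; last by rewrite setU1r.
rewrite -ltnS; apply: leq_trans ltSm; rewrite ltnS.
apply: proper_card; apply/properP; split.
  by rewrite setCS subsetUr.
by exists w; rewrite !inE ?eqxx ?wS.
Qed.

End Greedy.

(** * Saturation of the Hamming graph *)

Section Saturation.
Variables (T : sgraph) (n k : nat) (v : T).
Hypotheses (acT : acyclic T) (conT : connected T) (k_gt : #|T| < k).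
Hypothesis deg_v : degree v = n.+1.
Hypothesis deg_le : forall u, u != v -> degree u <= n.

Lemma hamming_free : ~ induced_sub T (hamming n k).
Proof.
case/induced_subP=> f inj_f adj_f.
pose N := [set u | adj v u].
pose P u i := diff (f v) (f u) == [set i].
have N_gt0 : 0 < #|N| by rewrite [#|N|]deg_v.
have [u0] := card_gt0P N_gt0; rewrite inE -adj_f => /hamming_adjP[i0 _].
(* On [N], [d u] is the direction from [f v] to [f u]; [i0] is only a default value. *)
pose d u := odflt i0 [pick i | P u i].
have dP u : u \in N -> diff (f v) (f u) = [set d u].
  rewrite inE -adj_f => /hamming_adjP[i eq_i]; rewrite /d.
  case: pickP => [j /eqP//|/(_ i)]; by rewrite /P eq_i eqxx.
(* Two neighbours in one direction would be adjacent, giving a triangle through [v]. *)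
have d_inj : {in N &, injective d}.
  move=> a b aN bN eq_d; apply/eqP/negPn/negP => ab.
  have: adj (f a) (f b).
    by apply: (diff_line (dP a aN)); rewrite ?eq_d ?dP // (inj_eq inj_f).
  rewrite adj_f; move: aN bN; rewrite !inE adj_sym => av vb.
  by rewrite (negPf (acyclic_triangle_free acT av vb)).
have := max_card (d @: N).
by rewrite card_in_imset // [#|N|]deg_v card_ord ltnn.
Qed.

Lemma neighbour_degree a : adj v a -> degree a <= n.
Proof.
by move=> va; apply: deg_le; apply: contraTneq va => ->; rewrite adj_irr.
Qed.

Lemma hamming_add (e : {set hamming n k}) :
  e \in edges (compl (hamming n k)) -> induced_sub T (add_edge e).
Proof.
case/imsetP=> -[x y]; rewrite inE /= => /andP[xy nxy] eq_e.
have /card_gt0P[a] : 0 < #|[set u | adj v u]| by rewrite [#|_|]deg_v.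
rewrite inE => va.
have av : a != v by apply: contraTneq va => ->; rewrite adj_irr.
pose f u := if u == v then x else y.
have fv : f v = x by rewrite /f eqxx.
have fa : f a = y by rewrite /f (negPf av).
have A_hamming z t : z \notin e -> add_adj e z t = hamming_adj z t.
  move=> ze; rewrite /add_adj; have [<-|zt] := eqVneq z t.
    by rewrite (hamming_irr z).
  rewrite (_ : (_ == e) = false) ?orbF //; apply: contraNF ze => /eqP<-.
  by rewrite !inE eqxx.
suff emb : partial_embedding e (@add_adj _ e) [set v; a] f.
  have [g inj_g adj_g] := partial_embedding_total acT conT k_gt (@add_sym _ e)
    (@add_irr _ e) A_hamming (set21 v a) emb.
  exact: (induced_sub_inj (G := add_edge e) inj_g adj_g).
(* The ends of the added edge differ in at least two coordinates, so all [n] directions remain for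
   the other [n] neighbours of [v]. *)
have dirs0 p : p \in [set v; a] -> dirs [set v; a] f p = set0.
  move=> pS; apply/setP => i; rewrite !inE; apply/existsP => -[q /andP[qS]].
  have nxyi : diff x y == [set i] = false.
    by apply: contraNF nxy => /eqP eq_i; apply/hamming_adjP; exists i.
  by case/set2P: pS => ->; case/set2P: qS => ->;
    rewrite ?fv ?fa ?diffxx_set1 ?nxyi // diffC nxyi.
split.
- have v1 : connected_in [set v] by move=> ? ? /set1P-> /set1P->.
  rewrite setUC; exact: connected_inU1 v1 (set11 v) va.
- by rewrite imsetU1 imset_set1 fv fa eq_e.
- move=> p q /set2P[]-> /set2P[]->; rewrite ?fv ?fa // => eq_xy.
    by rewrite eq_xy eqxx in xy.
  by rewrite eq_xy eqxx in xy.
- move=> p q /set2P[]-> /set2P[]->; rewrite ?fv ?fa ?add_irr ?adj_irr //.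
    by rewrite va /add_adj xy eq_e eqxx orbT.
  by rewrite add_sym adj_sym va /add_adj xy eq_e eqxx orbT.
- move=> p pS; rewrite dirs0 // cards0 add0n; case/set2P: pS => ->.
    rewrite -ltnS -deg_v; apply: missing_card_degree va.
    by rewrite !inE eqxx orbT.
  apply: leq_trans (neighbour_degree va); apply: ltnW.
  apply: (@missing_card_degree _ _ _ v); first by rewrite !inE eqxx.
  by rewrite adj_sym.
- by move=> p; rewrite !inE negb_or => /andP[/deg_le].
Qed.

Hypotheses (n_gt0 : 0 < n) (k_ge3 : 2 < k).

Lemma hamming_del (e : {set hamming n k}) :
  e \in edges (hamming n k) -> induced_sub T (del_edge e).
Proof.
case/imsetP=> -[x y]; rewrite inE /= => /hamming_adjP[i xy] eq_e.
have /card_gt1P[a [b [va vb ab]]] : 1 < #|[set u | adj v u]|.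
  by rewrite [#|_|]deg_v ltnS.
rewrite !inE in va vb.
have av : a != v by apply: contraTneq va => ->; rewrite adj_irr.
have bv : b != v by apply: contraTneq vb => ->; rewrite adj_irr.
have nab : ~~ adj a b by rewrite (acyclic_triangle_free acT _ vb) // adj_sym.
(* A third value in coordinate [i] gives the third point [z] of the line through [x] and [y]. *)
have [c] : exists c, c \notin [set x i; y i].
  apply/existsP; rewrite -negb_forall; apply/negP => /forallP all_c.
  have: #|[set x i; y i]| <= 2 by rewrite cards2; case: (_ != _).
  rewrite (_ : [set x i; y i] = setT) ?cardsT ?card_ord 1?leqNgt ?k_ge3 //.
  by apply/setP => j; rewrite all_c inE.
rewrite !inE negb_or => /andP[cx cy].
pose z : hamming n k := upd x i c.
have zx : diff z x = [set i] by rewrite diff_upd // diffxx setU0.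
have zy : diff z y = [set i] by rewrite diff_upd // xy setUid.
have neq (s t : hamming n k) : diff s t = [set i] -> s <> t.
  by move=> + eq_st; rewrite eq_st diffxx => /setP/(_ i); rewrite !inE eqxx.
have adj_line (s t : hamming n k) : diff s t = [set i] -> hamming_adj s t.
  by move=> st; apply/hamming_adjP; exists i.
pose f u := if u == v then z else if u == a then x else y.
have fv : f v = z by rewrite /f eqxx.
have fa : f a = x by rewrite /f (negPf av) eqxx.
have fb : f b = y by rewrite /f (negPf bv) eq_sym (negPf ab).
pose S := b |: [set v; a].
have SP p : p \in S -> [\/ p = v, p = a | p = b].
  by case/setU1P=> [->|/set2P[]->]; [apply: Or33|apply: Or31|apply: Or32].
have [vS aS bS] : [/\ v \in S, a \in S & b \in S].
  by rewrite !inE !eqxx !orbT.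
have ze : z \notin e.
  by rewrite eq_e !inE negb_or; apply/andP; split; apply/eqP/neq.
have A_hamming s t : s \notin e -> del_adj e s t = hamming_adj s t.
  move=> se; rewrite /del_adj (contraNneq _ se) ?andbT // => <-.
  by rewrite !inE eqxx.
suff emb : partial_embedding e (@del_adj _ e) S f.
  have [g inj_g adj_g] := partial_embedding_total acT conT k_gt (@del_sym _ e)
    (@del_irr _ e) A_hamming vS emb.
  exact: (induced_sub_inj (G := del_edge e) inj_g adj_g).
(* All three points lie on one line, so both placed neighbours of [v] cost a single direction. *)
have dirs_sub p : p \in S -> dirs S f p \subset [set i].
  move=> pS; apply/subsetP => j; rewrite !inE => /existsP[q /andP[qS]].
  by case/SP: pS => ->; case/SP: qS => ->; rewrite ?fv ?fa ?fb ?diffxx_set1 //;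
    rewrite ?(zx, zy, xy) 1?diffC ?(zx, zy, xy) (inj_eq set1_inj) eq_sym.
split=> //.
- have v1 : connected_in [set v] by move=> ? ? /set1P-> /set1P->.
  apply: (connected_inU1 (p := v)) vb; last by rewrite !inE eqxx.
  by rewrite setUC; apply: connected_inU1 v1 (set11 v) va.
- by apply/subsetP => t; rewrite eq_e => /set2P[]->;
    [rewrite -fa|rewrite -fb]; apply: imset_f.
- by move=> p q /SP[]-> /SP[]->; rewrite ?fv ?fa ?fb //;
    [move/(neq _ _ zx)|move/(neq _ _ zy)|move/esym/(neq _ _ zx)
    |move/(neq _ _ xy)|move/esym/(neq _ _ zy)|move/esym/(neq _ _ xy)].
- have del_xy : del_adj e x y = false by rewrite /del_adj eq_e eqxx andbF.
  move=> p q /SP[]-> /SP[]->; rewrite ?fv ?fa ?fb ?del_irr ?adj_irr //.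
  + by rewrite A_hamming // va adj_line.
  + by rewrite A_hamming // vb adj_line.
  + by rewrite del_sym A_hamming // (adj_sym a) va adj_line.
  + by rewrite del_xy (negPf nab).
  + by rewrite del_sym A_hamming // (adj_sym b) vb adj_line.
  + by rewrite del_sym del_xy (adj_sym b) (negPf nab).
- move=> p pS; apply: (@leq_trans (1 + #|missing S p|)).
    by rewrite leq_add2r -(cards1 i) subset_leq_card ?dirs_sub.
  case/SP: pS => ->.
  (* With [a] and [b] placed, [n - 1] neighbours of [v] are missing; direction [i] brings the total
     to [n]. *)
  + rewrite -ltnS -deg_v.
    apply: leq_ltn_trans (missing_card_degree (set11 a) va).
    apply: proper_card; apply/properP; split.
      by apply/subsetP => u; rewrite !inE !negb_or => /andP[-> /and3P[]].
    by exists b; rewrite !inE ?vb ?eqxx //= eq_sym.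
  + apply: leq_trans (neighbour_degree va).
    by apply: (missing_card_degree vS); rewrite adj_sym.
  + apply: leq_trans (neighbour_degree vb).
    by apply: (missing_card_degree vS); rewrite adj_sym.
- by move=> p; rewrite !inE !negb_or => /and3P[_ /deg_le].
Qed.

Lemma hamming_saturated : induced_saturated T (hamming n k).
Proof.
split; [|exact: hamming_free|exact: hamming_del|exact: hamming_add].
rewrite card_ffun !card_ord; apply: leq_trans (ltnW k_ge3) _.
by rewrite -{1}[k]expn1 leq_pexp2l // (leq_trans _ k_ge3).
Qed.

End Saturation.

Theorem corollary2 (n : nat) (hn : 3 <= n) (T : sgraph) (hT : tree_class n T) :
  exists k : nat, 0 < k /\ induced_saturated T (hamming n k).
Proof.
case: hT => -[conT acT] [v [[deg_v uniq_v] maxT _]].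
(* This exceeds [#|T|], for fresh values, and is at least 3, for a third point on each line. *)
exists #|T|.+3; split=> //.
apply: (@hamming_saturated _ _ _ v) => //.
- by rewrite ltnS -addn2 leq_addr.
- by rewrite deg_v.
(* Only [v] attains the maximum degree [n.+1]. *)
- move=> u uv; rewrite -ltnS -maxT ltn_neqAle; apply/andP; split.
    by apply: contraNneq uv => /uniq_v->.
  exact: (leq_bigmax u).
- exact: ltnW (ltnW hn).
Qed.
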